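(* Let $\Gamma\cup\{\varphi\}\subseteq\mathfrak{Fm}_s$ with $\Gamma$ non-trivial maximal with respect to $\varphi$ in $\mathcal{H}^3_{\vee,\triangle}$, and let $\Gamma/\!\equiv_\vee=\{\overline{\alpha}:\alpha\in\Gamma\}\subseteq\mathfrak{Fm}_s/\!\equiv_\vee$. Then: (1) if $\alpha\in\Gamma$ and $\overline{\alpha}=\overline{\beta}$, then $\beta\in\Gamma$; (2) $\Gamma/\!\equiv_\vee$ is a modal deductive system of $\mathfrak{Fm}_s/\!\equiv_\vee$, $\overline{\varphi}\notin\Gamma/\!\equiv_\vee$, and every modal deductive system $\overline{D}$ of $\mathfrak{Fm}_s/\!\equiv_\vee$ properly containing $\Gamma/\!\equiv_\vee$ satisfies $\overline{\varphi}\in\overline{D}$.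
   Context: $\mathfrak{Fm}_s$ is the absolutely free algebra of formulas over a countable set of propositional variables in signature $\{\to,\vee,\triangle\}$. The calculus $\mathcal{H}^3_{\vee,\triangle}$ has axiom schemas (Ax1) $\alpha\to(\beta\to\alpha)$; (Ax2) $(\alpha\to(\beta\to\gamma))\to((\alpha\to\beta)\to(\alpha\to\gamma))$; (Ax3) $((\alpha\to\beta)\to\gamma)\to(((\gamma\to\alpha)\to\gamma)\to\gamma)$; (Ax4) $\alpha\to(\alpha\vee\beta)$; (Ax5) $\beta\to(\alpha\vee\beta)$; (Ax6) $(\alpha\to\gamma)\to((\beta\to\gamma)\to((\alpha\vee\beta)\to\gamma))$; (Ax7) $\triangle\alpha\to\alpha$; (Ax8) $\triangle(\triangle\alpha\to\beta)\to(\triangle\alpha\to\triangle\beta)$; (Ax9) $((\beta\to\triangle\beta)\to(\alpha\to\triangle(\alpha\to\beta)))\to\triangle(\alpha\to\beta)$; (Ax10) $((\triangle\alpha\to\beta)\to\gamma)\to((\triangle\alpha\to\gamma)\to\gamma)$; rules: modus ponens and necessitation (from $\alpha$ infer $\triangle\alpha$). $\Gamma\vdash_\vee\alpha$ denotes derivability from premises $\Gamma$. $\Gamma$ is non-trivial maximal with respect to $\varphi$ if $\Gamma\nvdash_\vee\varphi$ and $\Gamma\cup\{\psi\}\vdash_\vee\varphi$ for every formula $\psi\notin\Gamma$. $\alpha\equiv_\vee\beta$ iff $\vdash_\vee\alpha\to\beta$ and $\vdash_\vee\beta\to\alpha$; it is a congruence, $\overline{\alpha}$ is the class of $\alpha$,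 and the quotient $\mathfrak{Fm}_s/\!\equiv_\vee$ carries the induced operations $\to,\vee,\triangle$ with $1=\{\alpha:\vdash_\vee\alpha\}$. A modal deductive system of an algebra $(B,\to,\vee,\triangle,1)$ is $D\subseteq B$ with $1\in D$; $x,x\to y\in D$ implies $y\in D$; $x\in D$ implies $\triangle x\in D$. *)

(* Defs.v *)
From HB Require Import structures.
From mathcomp Require Import all_boot.
From mathcomp Require Import boolp classical_sets.

Set Implicit Arguments.
Unset Strict Implicit.
Unset Printing Implicit Defensive.

Local Open Scope classical_set_scope.
Local Open Scope quotient_scope.

Inductive formula : Type :=
  | Var of nat
  | Imp of formula & formula
  | Or of formula & formula
  | Tri of formula.

HB.instance Definition _ := gen_eqMixin formula.
HB.instance Definition _ := gen_choiceMixin formula.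

Declare Scope fm_scope.
Delimit Scope fm_scope with fm.
Bind Scope fm_scope with formula.
Notation "a ⇒ b" := (Imp a b) (at level 55, right associativity) : fm_scope.
Notation "a ⊔ b" := (Or a b) (at level 50, left associativity) : fm_scope.
Notation "△ a" := (Tri a) (at level 35, right associativity) : fm_scope.

Inductive axiom : formula -> Prop :=
  | Ax1 a b : axiom (a ⇒ (b ⇒ a))
  | Ax2 a b c : axiom ((a ⇒ (b ⇒ c)) ⇒ ((a ⇒ b) ⇒ (a ⇒ c)))
  | Ax3 a b c : axiom (((a ⇒ b) ⇒ c) ⇒ (((c ⇒ a) ⇒ c) ⇒ c))
  | Ax4 a b : axiom (a ⇒ (a ⊔ b))
  | Ax5 a b : axiom (b ⇒ (a ⊔ b))
  | Ax6 a b c : axiom ((a ⇒ c) ⇒ ((b ⇒ c) ⇒ ((a ⊔ b) ⇒ c)))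
  | Ax7 a : axiom (△ a ⇒ a)
  | Ax8 a b : axiom (△ (△ a ⇒ b) ⇒ (△ a ⇒ △ b))
  | Ax9 a b :
      axiom (((b ⇒ △ b) ⇒ (a ⇒ △ (a ⇒ b))) ⇒ △ (a ⇒ b))
  | Ax10 a b c : axiom (((△ a ⇒ b) ⇒ c) ⇒ ((△ a ⇒ c) ⇒ c)).

(* Necessitation applies to every derived formula, including those that
   depend on premises in Gamma (global consequence). *)
Inductive derives (Gamma : set formula) : formula -> Prop :=
  | Dprem a : Gamma a -> derives Gamma a
  | Dax a : axiom a -> derives Gamma a
  | Dmp a b : derives Gamma a -> derives Gamma (a ⇒ b) -> derives Gamma b
  | Dnec a : derives Gamma a -> derives Gamma (△ a).

Definition theorem (a : formula) : Prop := derives set0 a.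

Definition nontrivial_maximal (Gamma : set formula) (phi : formula) : Prop :=
  ~ derives Gamma phi /\
  forall psi, ~ Gamma psi -> derives (Gamma `|` [set psi]) phi.

Definition fm_equiv (a b : formula) : Prop :=
  theorem (a ⇒ b) /\ theorem (b ⇒ a).

Lemma derives_weak G a b : derives G a -> derives G (b ⇒ a).
Proof. by move=> Ga; apply: Dmp Ga _; apply: Dax; apply: Ax1. Qed.

Lemma derives_S G a b c :
  derives G (a ⇒ (b ⇒ c)) -> derives G (a ⇒ b) -> derives G (a ⇒ c).
Proof.
move=> Gabc Gab; apply: Dmp Gab _; apply: Dmp Gabc _.
by apply: Dax; apply: Ax2.
Qed.

Lemma derives_id G a : derives G (a ⇒ a).
Proof.
apply: (@derives_S _ _ (a ⇒ a)); apply: Dax; first exact: (Ax1 a (a ⇒ a)).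
exact: Ax1.
Qed.

Lemma derives_trans G a b c :
  derives G (a ⇒ b) -> derives G (b ⇒ c) -> derives G (a ⇒ c).
Proof. by move=> Gab Gbc; apply: derives_S Gab; apply: derives_weak. Qed.

Lemma theorem_Imp a a' b b' :
  theorem (a' ⇒ a) -> theorem (b ⇒ b') -> theorem ((a ⇒ b) ⇒ (a' ⇒ b')).
Proof.
move=> Taa Tbb; apply: (@derives_trans _ _ (a ⇒ b')).
- by apply: Dmp (derives_weak a Tbb) _; apply: Dax; apply: Ax2.
- apply: (@derives_S _ _ (a' ⇒ a)); last exact: derives_weak.
  apply: (@derives_trans _ _ (a' ⇒ (a ⇒ b'))); apply: Dax.
    exact: Ax1.
  exact: Ax2.
Qed.

Lemma theorem_Or a a' b b' :
  theorem (a ⇒ a') -> theorem (b ⇒ b') -> theorem ((a ⊔ b) ⇒ (a' ⊔ b')).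
Proof.
move=> Taa Tbb.
have Ta : theorem (a ⇒ (a' ⊔ b')).
  by apply: derives_trans Taa _; apply: Dax; apply: Ax4.
have Tb : theorem (b ⇒ (a' ⊔ b')).
  by apply: derives_trans Tbb _; apply: Dax; apply: Ax5.
by apply: Dmp Tb _; apply: Dmp Ta _; apply: Dax; apply: Ax6.
Qed.

Lemma theorem_Tri a b : theorem (a ⇒ b) -> theorem (△ a ⇒ △ b).
Proof.
move=> Tab; have Tb : theorem (△ a ⇒ b).
  by apply: derives_trans Tab; apply: Dax; apply: Ax7.
by apply: Dmp (Dnec Tb) _; apply: Dax; apply: Ax8.
Qed.

Definition fm_equivb (a b : formula) : bool := `[< fm_equiv a b >].

Lemma fm_equivb_refl : reflexive fm_equivb.
Proof. by move=> a; apply/asboolP; split; apply: derives_id. Qed.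

Lemma fm_equivb_sym : symmetric fm_equivb.
Proof. by move=> a b; apply/asboolP/asboolP => -[]; split. Qed.

Lemma fm_equivb_trans : transitive fm_equivb.
Proof.
move=> b a c /asboolP[ab ba] /asboolP[bc cb]; apply/asboolP; split.
- exact: derives_trans ab bc.
- exact: derives_trans cb ba.
Qed.

Canonical fm_equiv_rel :=
  EquivRel fm_equivb fm_equivb_refl fm_equivb_sym fm_equivb_trans.

Definition Fmq : Type := {eq_quot fm_equiv_rel}.
HB.instance Definition _ := Choice.on Fmq.
HB.instance Definition _ := EqQuotient.on Fmq.

Definition cls (a : formula) : Fmq := \pi_Fmq a.

Lemma cls_eqP a b : cls a = cls b <-> fm_equiv a b.
Proof.
split=> [/eqquotP/asboolP//|ab].
by apply/eqquotP/asboolP.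
Qed.

Lemma cls_repr (x : Fmq) : cls (repr x) = x.
Proof. exact: reprK. Qed.

(* Defined on representatives; clsImp, clsOr and clsTri below show that these
   are the operations induced by the congruence. *)
Definition qImp (x y : Fmq) : Fmq := cls (repr x ⇒ repr y).
Definition qOr (x y : Fmq) : Fmq := cls (repr x ⊔ repr y).
Definition qTri (x : Fmq) : Fmq := cls (△ repr x).

(* The class of all theorems, see clsOneP. *)
Definition qOne : Fmq := cls (Var 0 ⇒ Var 0).

Lemma clsImp a b : cls (a ⇒ b) = qImp (cls a) (cls b).
Proof.
have /cls_eqP[a1 a2] := esym (cls_repr (cls a)).
have /cls_eqP[b1 b2] := esym (cls_repr (cls b)).
by apply/cls_eqP; split; apply: theorem_Imp.
Qed.

Lemma clsOr a b : cls (a ⊔ b) = qOr (cls a) (cls b).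
Proof.
have /cls_eqP[a1 a2] := esym (cls_repr (cls a)).
have /cls_eqP[b1 b2] := esym (cls_repr (cls b)).
by apply/cls_eqP; split; apply: theorem_Or.
Qed.

Lemma clsTri a : cls (△ a) = qTri (cls a).
Proof.
have /cls_eqP[a1 a2] := esym (cls_repr (cls a)).
by apply/cls_eqP; split; apply: theorem_Tri.
Qed.

Lemma clsOneP a : cls a = qOne <-> theorem a.
Proof.
split=> [/cls_eqP[_]|Ta].
- by apply: Dmp; apply: derives_id.
- by apply/cls_eqP; split; apply: derives_weak => //; apply: derives_id.
Qed.

Record algebra : Type := Algebra {
  carrier :> Type;
  aImp : carrier -> carrier -> carrier;
  aOr : carrier -> carrier -> carrier;
  aTri : carrier -> carrier;
  aOne : carrier }.

Definition Fm_quotient : algebra := Algebra qImp qOr qTri qOne.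

Definition modal_deductive_system (B : algebra) (D : set B) : Prop :=
  [/\ D (aOne B),
      (forall x y : B, D x -> D (aImp x y) -> D y)
    & (forall x : B, D x -> D (aTri x))].

Definition set_quotient (Gamma : set formula) : set Fm_quotient :=
  [set cls a | a in Gamma].

(* Main.v *)
(** A set that is maximal among those not deriving [phi] is closed under
    derivability: by the cut rule, adding a consequence of [Gamma] to [Gamma]
    cannot make [phi] derivable.  On the other side, the formulas whose class
    lies in a given modal deductive system are closed under derivability.  A
    system properly above the quotient of [Gamma] contains the class of some
    [psi] outside [Gamma], hence that of [phi], as [Gamma] together with [psi]
    derives [phi]. *)

Require Import Defs.
From mathcomp Require Import all_boot.
From mathcomp Require Import boolp classical_sets.

Local Open Scope classical_set_scope.

Lemma derives_cut (G H : set formula) (a : formula) :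
  (forall b, H b -> derives G b) -> derives H a -> derives G a.
Proof.
move=> HG; elim=> [b /HG //|b Ab|b c _ Gb _ Gbc|b _ Gb].
- exact: Dax.
- exact: Dmp Gb Gbc.
- exact: Dnec.
Qed.

Lemma nontrivial_maximal_closed (G : set formula) (phi a : formula) :
  nontrivial_maximal G phi -> derives G a -> G a.
Proof.
move=> [Gphi Gmax] Ga; apply: contrapT => /Gmax Gaphi; apply: Gphi.
by apply: derives_cut Gaphi => b [Gb|->] //; apply: Dprem.
Qed.

Lemma derives_mono (G H : set formula) (a : formula) :
  G `<=` H -> derives G a -> derives H a.
Proof. by move=> GH; apply: derives_cut => b /GH; apply: Dprem. Qed.

(** Induction on the derivation: an axiom has class [qOne], and the two rules match the two closure
    conditions on [D]. *)
Lemma modal_deductive_system_derives (D : set Fm_quotient)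
    (G : set formula) (a : formula) :
  modal_deductive_system D -> (forall b, G b -> D (cls b)) ->
  derives G a -> D (cls a).
Proof.
move=> [D1 Dimp Dtri] GD; elim=> [b /GD //|b Ab|b c _ Db|b _ Db].
- by have /clsOneP -> : theorem b by apply: Dax.
- by rewrite clsImp => _; apply: Dimp.
- by rewrite clsTri; apply: Dtri.
Qed.

Theorem mainTheorem13 (Gamma : set formula) (phi : formula)
    (Gamma_max : nontrivial_maximal Gamma phi) :
  (forall a b : formula, Gamma a -> cls a = cls b -> Gamma b) /\
  [/\ modal_deductive_system (set_quotient Gamma),
      ~ set_quotient Gamma (cls phi)
    & forall D : set Fm_quotient,
        modal_deductive_system D -> set_quotient Gamma `<` D -> D (cls phi)].
Proof.
have closed a : derives Gamma a -> Gamma a.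
  exact: nontrivial_maximal_closed Gamma_max.
have thmG a : theorem a -> derives Gamma a by apply: derives_mono.
have sat a b : Gamma a -> cls a = cls b -> Gamma b.
  move=> /Dprem Ga /cls_eqP[/thmG Gab _]; apply: closed; exact: Dmp Ga Gab.
(* The hypothesis only supplies some [b] in [Gamma] equivalent to [a]; [sat] carries membership over
   to [a]. *)
have clsG a : set_quotient Gamma (cls a) -> Gamma a by case=> b /sat; apply.
split=> //; split.
- split=> [|x y|x].
  + by exists (Imp (Var 0) (Var 0)) => //; apply/closed/derives_id.
  + rewrite -(cls_repr x) -(cls_repr y) /= -clsImp.
    move=> /clsG/Dprem Gx /clsG/Dprem Gxy.
    by exists (repr y) => //; apply: closed; apply: Dmp Gx Gxy.
  + rewrite -(cls_repr x) /= -clsTri => /clsG/Dprem Gx.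
    by exists (Tri (repr x)) => //; apply/closed/Dnec.
- by move=> /clsG/Dprem; case: Gamma_max.
- move=> D Dmds [GD /existsNP[x /not_implyP[Dx Gx]]].
  (* Since [x] is in [D] but not in the quotient of [Gamma], its representative is outside [Gamma]
     and maximality applies to it. *)
  apply: modal_deductive_system_derives (Gamma_max.2 (repr x) _) => //.
  + move=> b [Gb|->]; last by rewrite cls_repr.
    by apply: GD; exists b.
  + by move=> Gr; apply: Gx; exists (repr x) => //; apply: cls_repr.
Qed.
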